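(* Let $\Omega$ be a bounded domain in $\mathbb{C}^n$. Suppose that there is a countable set $K\subset\partial\Omega$ such that every point of $\partial\Omega\setminus K$ is a $C^0$-boundary point of $\Omega$. Then $\Omega$ has the PSH-Mergelyan property.
   Context: Identify $\mathbb{C}^n$ with $\mathbb{R}^{2n}$. A point $z\in\partial\Omega$ is called a $C^0$-boundary point of $\Omega$ if $\Omega$ has the Segment Property at $z$, i.e. there exist a neighborhood $U$ of $z$ and a vector $w\in\mathbb{C}^n$ such that $(U\cap\overline{\Omega})+tw\subset\Omega$ for all $0<t<1$. A domain $\Omega\subset\mathbb{C}^n$ has the PSH-Mergelyan property if every function $u$ that is plurisubharmonic on $\Omega$ and continuous on $\overline{\Omega}$ can be approximated uniformly on $\overline{\Omega}$ by continuous plurisubharmonic functions $v_j$ defined on domains $\Omega_j$ (depending on $j$, possibly shrinking) that contain $\overline{\Omega}$. *)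

(* Defs.v *)
From HB Require Import structures.
From mathcomp Require Import all_boot all_order all_algebra.
From mathcomp Require Import all_classical all_reals all_analysis.
From mathcomp Require Import complex.

Set Implicit Arguments.
Unset Strict Implicit.
Unset Printing Implicit Defensive.

Import Order.TTheory GRing.Theory Num.Theory.
Import numFieldNormedType.Exports.

Local Open Scope classical_set_scope.
Local Open Scope ring_scope.
Local Open Scope complex_scope.

(* The topology on R[i] is the one of its complex-valued norm [`|.|]. *)
HB.instance Definition _ (R : realType) := NormedModule.copy R[i] R[i]^o.

(* Points of C^n are row vectors over R[i]; ['rV[R[i]]_n] carries the sup norm,
   which induces the topology and the bounded sets of R^(2n). *)

Definition is_domain (T : topologicalType) (D : set T) : Prop :=
  [/\ D !=set0, open D & connected D].

Definition boundary (T : topologicalType) (A : set T) : set T :=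
  closure A `\` A°.

Definition C0_boundary_point (R : realType) (n : nat)
    (Omega : set 'rV[R[i]]_n) (z : 'rV[R[i]]_n) : Prop :=
  boundary Omega z /\
  exists U (w : 'rV[R[i]]_n), nbhs z U /\
    forall t : R, 0 < t < 1 ->
      [set p + t%:C *: w | p in U `&` closure Omega] `<=` Omega.

(* Functions are total; only their values on the set of interest matter. *)
Definition usc_on (T : topologicalType) (R : realType) (U : set T)
    (f : T -> \bar R) : Prop :=
  forall x, U x -> forall a : R, (f x < a%:E)%E ->
    \forall y \near within U (nbhs x), (f y < a%:E)%E.

Definition circle_mean (R : realType) (f : R[i] -> \bar R) (c : R[i]) (r : R)
    : \bar R :=
  (((2 * pi)^-1)%:E *
   \int[lebesgue_measure]_(t in `[0%R, (2 * pi)%R])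
     f (c + r%:C * (cos t +i* sin t))%R)%E.

(* The value -oo is allowed, also identically, as is customary for the slices
   of a plurisubharmonic function. *)
Definition subharmonic_on (R : realType) (U : set R[i]) (f : R[i] -> \bar R)
    : Prop :=
  [/\ forall x, U x -> (f x < +oo)%E,
      usc_on U f &
      forall (c : R[i]) (r : R), 0 < r ->
        [set x : R[i] | `|x - c| <= r%:C] `<=` U ->
        (f c <= circle_mean f c r)%E].

Definition plurisubharmonic_on (R : realType) (n : nat)
    (D : set 'rV[R[i]]_n) (u : 'rV[R[i]]_n -> \bar R) : Prop :=
  [/\ forall z, D z -> (u z < +oo)%E,
      usc_on D u &
      forall a b : 'rV[R[i]]_n,
        subharmonic_on [set x : R[i] | D (a + x *: b)]
                       (fun x => u (a + x *: b))].

Definition PSH_Mergelyan (R : realType) (n : nat) (Omega : set 'rV[R[i]]_n)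
    : Prop :=
  forall u : 'rV[R[i]]_n -> R,
    plurisubharmonic_on Omega (EFin \o u) ->
    {within closure Omega, continuous u} ->
    exists (D : nat -> set 'rV[R[i]]_n) (v : nat -> 'rV[R[i]]_n -> R),
      (forall j, [/\ is_domain (D j), closure Omega `<=` D j,
                     {within D j, continuous (v j)} &
                     plurisubharmonic_on (D j) (EFin \o v j)]) /\
      {uniform closure Omega, v @ \oo --> u}.

(* Main.v *)
Require Import Defs.
From mathcomp Require Import all_boot all_order all_algebra.
From mathcomp Require Import all_classical all_reals all_analysis.
From mathcomp Require Import complex.
From mathcomp Require Import ring lra.

(** Let X be the closure of Omega, a compact set.  The approximant is built by
    modifying u finitely many times; each modification changes it on X by a
    small amount, keeps it continuous on X, and makes it plurisubharmonic near
    more points of X than before.  Both kinds of modification take the maximum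
    of two functions f and g in a shell, f outside it and g inside it
    ([maxglue]).  Such a gluing is continuous and plurisubharmonic as soon as
    f < g on the inner sphere and g < f on the outer one.

    - Around any single point a of X ([extend_over_point]), take
      f = u + k log |q - a| with k tiny and g a constant slightly below u(a).
      For small k the logarithm is negligible on the outer sphere and on the
      rest of X, and yet it pushes f below g on a much smaller inner sphere.
      The size of the new neighbourhood of a depends on the accuracy.

    - Around a boundary point z with the Segment Property
      ([extend_near_C0]), take f = u + k |q|^2 and g = u(q + t w) plus k times
      the pluriharmonic function |q|^2 - |q - z|^2 + const, whose difference
      with |q|^2 has opposite signs on the two spheres.  Given k, uniform
      continuity makes the translation error smaller than this gap once t is
      small.  Here the neighbourhood of z does not depend on the function or on
      the accuracy.

    The first construction is applied successively at the points of the
    countable set, with errors forming a geometric series.  The sets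
    of points near which the successive functions are plurisubharmonic are open,
    they increase, and they cover Omega and the exceptional points.  Together
    with the fixed neighbourhoods of the other boundary points they cover X, so
    by compactness one member of the sequence and finitely many applications of
    the second construction suffice ([exists_psh_approximation]).  The required
    domain is the connected component, containing X, of the set of points near
    which the approximant is plurisubharmonic.

    Gluing only gives the sub-mean value inequality on small discs, whereas
    plurisubharmonicity asks for it on every disc contained in the domain.  The
    passage from local to global ([submean_global]) avoids Poisson integrals:
    averaging the function over a finite group of rotations of the disc keeps
    the local inequality, so the average obeys the maximum principle; on the
    boundary circle the average is almost constant, equal to the circle mean.
    To make such averages elementary, circle means of continuous functions are
    handled as limits of Riemann sums over the 2^m-th roots of unity; this also
    reduces the subharmonicity of the logarithm to the identity
    (1 + x)(1 - x) = 1 - x^2. *)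

Import Order.TTheory GRing.Theory Num.Theory.
Import numFieldNormedType.Exports.

Local Open Scope classical_set_scope.
Local Open Scope ring_scope.
Local Open Scope complex_scope.

(** * Dyadic Riemann sums on the circle *)

Section DyadicMean.
Context {R : realType}.
Implicit Types f g : R -> R.

Definition dyadic_step (m : nat) : R := 2 * pi / 2 ^+ m.

Definition dyadic_mean (m : nat) f : R :=
  (2 ^+ m)^-1 * \sum_(k < 2 ^ m) f (k%:R * dyadic_step m).

Lemma pow2_gt0 m : 0 < 2 ^+ m :> R.
Proof. by rewrite exprn_gt0. Qed.

Lemma pow2_neq0 m : 2 ^+ m != 0 :> R.
Proof. by rewrite gt_eqF ?pow2_gt0. Qed.

Lemma dyadic_step_gt0 m : 0 < dyadic_step m.
Proof. by rewrite divr_gt0 ?pow2_gt0// mulr_gt0 ?pi_gt0. Qed.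

Lemma pow2_dyadic_step m : (2 ^ m)%N%:R * dyadic_step m = 2 * pi.
Proof. by rewrite natrX mulrC /dyadic_step divfK ?pow2_neq0. Qed.

Lemma dyadic_mean_le m f g : (forall t, 0 <= t <= 2 * pi -> f t <= g t) ->
  dyadic_mean m f <= dyadic_mean m g.
Proof.
move=> fg; rewrite ler_wpM2l ?invr_ge0 ?exprn_ge0// ler_sum// => k _.
apply: fg; rewrite mulr_ge0 ?(ltW (dyadic_step_gt0 m))//= -(pow2_dyadic_step m).
by rewrite ler_pM2r ?dyadic_step_gt0// ler_nat ltnW.
Qed.

Lemma dyadic_mean_cst m c : dyadic_mean m (fun=> c) = c.
Proof.
rewrite /dyadic_mean sumr_const card_ord -[c *+ _]mulr_natl natrX mulrA.
by rewrite mulVf ?mul1r// pow2_neq0.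
Qed.

Lemma dyadic_meanD m f g :
  dyadic_mean m (fun t => f t + g t) = dyadic_mean m f + dyadic_mean m g.
Proof. by rewrite /dyadic_mean big_split/= mulrDr. Qed.

Lemma dyadic_meanZ m c f :
  dyadic_mean m (fun t => c * f t) = c * dyadic_mean m f.
Proof. by rewrite /dyadic_mean -mulr_sumr mulrCA. Qed.

Lemma dyadic_mean_eq m f g : f =1 g -> dyadic_mean m f = dyadic_mean m g.
Proof. by move=> fg; congr (_ * _); apply: eq_bigr. Qed.

(** Grouping antipodal nodes.  The halved angle makes squaring on the circle
    visible: this is what turns the product formula for (1 + x)(1 - x) into an
    induction on m. *)
Lemma dyadic_meanS m f :
  dyadic_mean m.+1 f =
  dyadic_mean m (fun t => (f (t / 2) + f (t / 2 + pi)) / 2).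
Proof.
have halfE k : k%:R * dyadic_step m.+1 = k%:R * dyadic_step m / 2.
  by rewrite /dyadic_step exprS invfM; ring.
rewrite /dyadic_mean expnS mul2n -addnn big_split_ord/= exprS invfM.
rewrite -big_split/= -mulrA mulrC -mulrA; congr (_ * _).
rewrite mulr_suml; apply: eq_bigr => k _.
congr (_ * _); rewrite -halfE natrD mulrDl.
congr (_ + f _); rewrite addrC; congr (_ + _).
by rewrite natrX /dyadic_step exprS; field; rewrite pow2_neq0.
Qed.

(** Rotating by a root of unity permutes the nodes. *)
Lemma dyadic_mean_shift m f j : (forall t, f (t + 2 * pi) = f t) ->
  dyadic_mean m (fun t => f (t + j%:R * dyadic_step m)) = dyadic_mean m f.
Proof.
move=> fper; elim: j => [|j <-].
  by apply: dyadic_mean_eq => t; rewrite mul0r addr0.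
rewrite /dyadic_mean; congr (_ * _).
have [n nE] : exists n, (2 ^ m)%N = n.+1.
  by exists (2 ^ m).-1; rewrite prednK ?expn_gt0.
have stepE : n.+1%:R * dyadic_step m = 2 * pi by rewrite -nE pow2_dyadic_step.
rewrite nE big_ord_recr big_ord_recl/= addrC; congr (_ + _).
  by rewrite -[RHS]fper -stepE mul0r add0r; congr f; rewrite -!natr1; ring.
by apply: eq_bigr => i _; congr f; rewrite /bump/= add1n -!natr1; ring.
Qed.

Lemma near_dyadic_step (d : R) : 0 < d ->
  \forall m \near \oo, dyadic_step m < d.
Proof.
move=> d0; have : (fun m => (2 * pi) * (2^-1 : R) ^+ m) @ \oo --> (2 * pi) * 0.
  apply: cvgM; first exact: cvg_cst.
  by apply: cvg_expr; rewrite ger0_norm//; lra.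
rewrite mulr0 => /cvgrPdist_lt /(_ d d0); apply: filterS => m.
rewrite sub0r normrN ger0_norm ?exprVn//.
by rewrite ltW// dyadic_step_gt0.
Qed.

Lemma unif_continuous_segment f (L : R) : continuous f ->
  forall e, 0 < e -> exists2 d, 0 < d &
    forall s t, 0 <= s <= L -> `|s - t| < d -> `|f s - f t| < e.
Proof.
move=> cf e e0.
have [d /= d0 H] : \forall d \near (0 : R)^'+, `[0, L] `<=`
    [set s | forall t, `|s - t| < d -> `|f s - f t| < e].
  apply: (compact_near_coveringP `[0, L]).1; first exact: segment_compact.
  move=> x _.
  have /cvgrPdist_lt/(_ (e / 2))[|d /= d0 df] := cf x;
    first by rewrite divr_gt0.
  near=> z => t /=.
  have h1 : `|x - z.1| < d / 2.
    near: z; exists (ball x (d / 2), setT); last by move=> z [].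
    by split; [apply: nbhsx_ballx; rewrite divr_gt0|exact: filterT].
  have h2 : z.2 < d / 2.
    near: z; exists (setT, [set y | y < d / 2]); last by move=> z [].
    by split; [exact: filterT|apply: nbhs_right_lt; rewrite divr_gt0].
  move=> zt.
  rewrite (le_lt_trans (ler_distD (f x) _ _))// [e]splitr ltrD//
    ?(distrC (f z.1)); apply: df => /=.
    by rewrite /ball_ (lt_le_trans h1)// ler_pdivrMr//; lra.
  rewrite /ball_ (le_lt_trans (ler_distD z.1 _ _))// [d]splitr ltrD//.
  exact: lt_trans zt h2.
exists (d / 2); first by rewrite divr_gt0.
move=> s t sL; apply: H => //=.
  by rewrite /ball_/= sub0r normrN gtr0_norm ?divr_gt0// ltr_pdivrMr//; lra.
by rewrite divr_gt0.
Unshelve. all: by end_near. Qed.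

End DyadicMean.

Section Bridge.
Context {R : realType}.
Implicit Types f g : R -> R.

(** The integral starts at [a - 1] so that [a] itself is an interior point and
    gets a two-sided derivative. *)
Lemma continuous_antiderivative f (a b : R) : continuous f ->
  exists G : R -> R, forall x, a <= x <= b -> is_derive x 1 G (f x).
Proof.
move=> cf; exists (fun x => \int[lebesgue_measure]_(t in `[a - 1, x]) f t).
move=> x /andP[ax xb].
have [||||d dE] := @continuous_FTC1_closed R f (a - 1) x (b + 1).
- lra.
- apply: continuous_compact_integrable; first exact: segment_compact.
  exact: continuous_subspaceT.
- lra.
- exact: cf.
by split => //; rewrite -derive1E.
Qed.

(** With an antiderivative G, the mean value theorem on each dyadic arc turns
    the telescoping sum for G(2 pi) - G(0) into a Riemann sum whose nodes differ
    from the dyadic ones by less than one step. *)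
Lemma dyadic_mean_cvg f : continuous f -> exists l,
  dyadic_mean ^~ f @ \oo --> l /\
  (\int[lebesgue_measure]_(t in `[0%R, (2 * pi)%R]) (f t)%:E)%E =
    (2 * pi * l)%:E.
Proof.
move=> cf; have [G dG] := @continuous_antiderivative f 0 (2 * pi) cf.
have pi20 : 0 < 2 * pi :> R by rewrite mulr_gt0 ?pi_gt0.
have cG x : 0 <= x <= 2 * pi -> {for x, continuous G}.
  by move=> /dG [dx _]; apply/differentiable_continuous/derivable1_diffP.
exists ((2 * pi)^-1 * (G (2 * pi) - G 0)); split; last first.
  rewrite mulrA divff ?gt_eqF// mul1r EFinB; apply: continuous_FTC2 => //.
  - exact: continuous_subspaceT.
  - split.
    + move=> x; rewrite in_itv/= => /andP[x0 x1].
      by have [] := dG x _; rewrite ?ltW.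
    + by apply: cvg_at_right_filter; apply: cG; rewrite lexx ltW.
    + by apply: cvg_at_left_filter; apply: cG; rewrite lexx ltW.
  - move=> x; rewrite in_itv/= => /andP[x0 x1].
    have [] := dG x _; rewrite ?ltW// => dx <-.
    by rewrite derive1E.
apply/cvgrPdist_le => e e0.
have [d d0 df] := @unif_continuous_segment _ f (2 * pi) cf _ e0.
have := @near_dyadic_step R _ d0; apply: filterS => m md.
set h := dyadic_step m in md; have h0 : 0 < h := dyadic_step_gt0 m.
have kle (k : 'I_(2 ^ m)) : k.+1%:R * h <= 2 * pi.
  by rewrite -(pow2_dyadic_step m) ler_pM2r// ler_nat.
have -> : G (2 * pi) - G 0 = \sum_(k < 2 ^ m) (G (k.+1%:R * h) - G (k%:R * h)).
  rewrite -(big_mkord predT (fun k => G (k.+1%:R * h) - G (k%:R * h))).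
  by rewrite (telescope_sumr (fun k => G (k%:R * h)))// pow2_dyadic_step mul0r.
have -> : (2 * pi)^-1 = (2 ^+ m)^-1 * h^-1 :> R.
  by rewrite /h /dyadic_step invf_div mulrA mulVf ?pow2_neq0// mul1r.
rewrite -mulrA -mulrBr normrM ger0_norm ?invr_ge0 ?exprn_ge0//.
rewrite ler_pdivrMl ?pow2_gt0// mulr_sumr -sumrB.
rewrite (le_trans (ler_norm_sum _ _ _))//
  (@le_trans _ _ (\sum_(k < 2 ^ m) e))//; last first.
  by rewrite sumr_const card_ord -[e *+ _]mulr_natl natrX.
apply: ler_sum => k _.
have hk0 : 0 <= k%:R * h by rewrite mulr_ge0// ltW.
have hk : k.+1%:R * h - k%:R * h = h by rewrite -natr1; ring.
have hk1 : k%:R * h < k.+1%:R * h by rewrite -subr_gt0 hk.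
have [|||c] := @MVT _ G f (k%:R * h) (k.+1%:R * h) _ _ _.
- exact: hk1.
- move=> x; rewrite in_itv/= => /andP[x0 x1]; apply: dG.
  by rewrite (le_trans hk0 (ltW x0)) (le_trans (ltW x1) (kle k)).
- apply: continuous_in_subspaceT => x; rewrite inE/= in_itv/= => /andP[x0 x1].
  by apply: cG; rewrite (le_trans hk0 x0) (le_trans x1 (kle k)).
rewrite in_itv/= => /andP[c0 c1] ->; rewrite hk mulrC mulfK ?gt_eqF//.
rewrite distrC ltW// df ?hk0 ?(le_trans (ltW hk1) (kle k))//.
rewrite distrC ger0_norm ?subr_ge0 ?(ltW c0)//.
by rewrite (lt_trans _ md)// -hk ltrD2r.
Qed.

End Bridge.

(** * The real-valued norm and the unit circle *)

Section RealNorm.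
Context {R : realType}.

(** The norm of a complex normed space takes its values in [R[i]]; this is the
    same number as an element of [R], where the order is total. *)
Definition nrm {M : normedModType R[i]} (x : M) : R := complex.Re `|x|.

Section Generic.
Context {M : normedModType R[i]}.
Implicit Types x y : M.

Lemma nrmE x : `|x| = (nrm x)%:C.
Proof. by rewrite /nrm RRe_real// ger0_real. Qed.

Lemma nrm_ge0 x : 0 <= nrm x.
Proof. by rewrite -ler0c -nrmE. Qed.

Lemma nrm0 : nrm (0 : M) = 0.
Proof. by rewrite /nrm normr0. Qed.

Lemma nrm_eq0 x : (nrm x == 0) = (x == 0).
Proof.
apply/eqP/eqP => [x0|->]; last exact: nrm0.
by apply/eqP; rewrite -normr_eq0 nrmE x0.
Qed.

Lemma nrm_gt0 x : (0 < nrm x) = (x != 0).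
Proof. by rewrite lt_def nrm_ge0 andbT nrm_eq0. Qed.

Lemma nrmN x : nrm (- x) = nrm x.
Proof. by rewrite /nrm normrN. Qed.

Lemma nrmC x y : nrm (x - y) = nrm (y - x).
Proof. by rewrite -nrmN opprB. Qed.

Lemma nrmD x y : nrm (x + y) <= nrm x + nrm y.
Proof. by rewrite -lecR rmorphD/= -!nrmE ler_normD. Qed.

Lemma nbhs_nrmP x (P : set M) :
  nbhs x P <-> exists2 e : R, 0 < e & forall y, nrm (y - x) < e -> P y.
Proof.
rewrite -nbhs_nbhs_norm; split => [[e /= e0 eP]|[e e0 eP]].
  have eE : e = (complex.Re e)%:C by rewrite RRe_real// gtr0_real.
  exists (complex.Re e); first by rewrite -(ltcR 0) -eE.
  move=> y xy; apply: eP => /=.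
  by rewrite distrC nrmE eE ltcR.
exists e%:C; first by rewrite /= (ltcR 0 e).
move=> y /=; rewrite distrC nrmE ltcR; exact: eP.
Qed.

Lemma continuous_nrm : continuous (@nrm M).
Proof.
move=> x; apply/cvgrPdist_lt => e e0; apply/nbhs_nrmP; exists e => // y xy.
apply: le_lt_trans xy; rewrite ler_norml.
have := nrmD (x - y) y; have := nrmD (y - x) x.
rewrite !subrK (nrmC x y); lra.
Qed.

End Generic.

Lemma nrmZ (M : normedModType R[i]) (a : R[i]) (x : M) :
  nrm (a *: x) = nrm a * nrm x.
Proof. by apply: complexI; rewrite rmorphM/= -!nrmE normrZ. Qed.

Lemma nrmM (a b : R[i]) : nrm (a * b) = nrm a * nrm b.
Proof. by apply: complexI; rewrite rmorphM/= -!nrmE normrM. Qed.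

Lemma nrm_complex (z : R[i]) :
  nrm z ^+ 2 = complex.Re z ^+ 2 + complex.Im z ^+ 2.
Proof. by apply: complexI; rewrite rmorphXn/= -nrmE add_Re2_Im2. Qed.

Lemma nrm_real (x : R) : nrm x%:C = `|x|.
Proof.
by apply/eqP; rewrite -(eqrXn2 (n:=2))// ?nrm_ge0// nrm_complex/= expr0n/=
  addr0 real_normK ?num_real.
Qed.

Lemma nrm_Re (z : R[i]) : `|complex.Re z| <= nrm z.
Proof. by rewrite -lecR -nrmE normc_ge_Re. Qed.

Lemma nrm_Im (z : R[i]) : `|complex.Im z| <= nrm z.
Proof.
by rewrite -(ler_pXn2r (n:=2)) ?nnegrE ?nrm_ge0// nrm_complex real_normK
  ?num_real// lerDr sqr_ge0.
Qed.

Lemma continuous_real_complex : continuous (real_complex R).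
Proof.
move=> x P /nbhs_nrmP[e e0 eP]; exists e => // y /= xy.
by apply: eP; rewrite -rmorphB nrm_real distrC.
Qed.

Lemma cvg_complex {T : Type} {F : set_system T} {FF : Filter F}
    (f g : T -> R) a b :
  f @ F --> a -> g @ F --> b -> (fun t => f t +i* g t) @ F --> a +i* b.
Proof.
move=> fa gb; rewrite (complexE (a +i* b)).
under eq_fun do rewrite (complexE (_ +i* _)).
apply: cvgD => /=; first exact: continuous_cvg (continuous_real_complex _) fa.
apply: cvgM; first exact: cvg_cst.
exact: continuous_cvg (continuous_real_complex _) gb.
Qed.

Definition cis (t : R) : R[i] := cos t +i* sin t.

Lemma continuous_cis : continuous cis.
Proof.
by move=> t; apply: cvg_complex; [exact: continuous_cos|exact: continuous_sin].
Qed.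

Lemma nrm_cis t : nrm (cis t) = 1.
Proof.
by apply/eqP; rewrite -(eqrXn2 (n:=2)) ?nrm_ge0// nrm_complex/= cos2Dsin2
  expr1n.
Qed.

Lemma cis0 : cis 0 = 1.
Proof. by rewrite /cis cos0 sin0. Qed.

Lemma cisD s t : cis (s + t) = cis s * cis t.
Proof.
rewrite /cis cosD sinD; apply/eqP; rewrite eq_complex/=.
by rewrite eqxx/= addrC.
Qed.

Lemma cisDpi t : cis (t + pi) = - cis t.
Proof. by rewrite /cis cosDpi sinDpi. Qed.

Lemma cisD2pi t : cis (t + 2 * pi) = cis t.
Proof. by rewrite mulr_natl mulr2n addrA !cisDpi opprK. Qed.

Lemma cis_surj (z : R[i]) : nrm z = 1 ->
  exists2 t, 0 <= t <= 2 * pi & z = cis t.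
Proof.
move=> z1; have := nrm_complex z; rewrite z1 expr1n.
case: z z1 => x y /= z1 xy.
have x1 : -1 <= x <= 1.
  by have := sqr_ge0 y; nra.
have pi0 := @pi_gt0 R.
have sE : sin (acos x) = `|y|.
  by rewrite sin_acos// -sqrtr_sqr; congr Num.sqrt; lra.
have [y0|y0] := leP 0 y.
  exists (acos x); first by rewrite acos_ge0//=; have := acos_lepi x1; lra.
  by rewrite /cis acosK ?in_itv// sE ger0_norm.
exists (- acos x + 2 * pi).
  by have := acos_lepi x1; have := acos_ge0 x1; lra.
by rewrite cisD2pi /cis cosN sinN acosK ?in_itv// sE ltr0_norm// opprK.
Qed.

Lemma compact_complex_disc (r : R) : compact [set x : R[i] | nrm x <= r].
Proof.
pose f (p : R * R) : R[i] := p.1 +i* p.2.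
have cf : continuous f.
  by move=> p; apply: cvg_complex; [exact: cvg_fst|exact: cvg_snd].
have /(continuous_compact (continuous_subspaceT cf)) :
    compact (`[- r, r] `*` `[- r, r] : set (R * R)).
  by apply: compact_setX; exact: segment_compact.
move=> cK; apply: (subclosed_compact _ cK); last first.
  move=> [x y] /= xyr; exists (x, y) => //; split;
    rewrite /= in_itv/= -ler_norml.
    exact: le_trans (nrm_Re (x +i* y)) xyr.
  exact: le_trans (nrm_Im (x +i* y)) xyr.
rewrite (_ : [set x | _] = nrm @^-1` [set y | y <= r])//.
by apply: closed_comp => [? _|]; [exact: continuous_nrm|exact: closed_le].
Qed.

End RealNorm.

(** * The discrete sub-mean value property *)

Section Submean.
Context {R : realType} {M : normedModType R[i]}.
Implicit Types (u f g : M -> R) (p q z b : M).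

(** The sub-mean value inequality on the circle [z + cis t *: b], with the mean
    replaced by the limit of its dyadic sums.  For continuous [u] it is the
    integral inequality, by [submean_circle]; in this form finite rotations and
    linear combinations need no integration theory. *)
Definition submean u z b : Prop := forall e : R, 0 < e ->
  \forall m \near \oo, u z <= dyadic_mean m (fun t => u (z + cis t *: b)) + e.

(** Plurisubharmonicity near [p]: the radius of the disc in the direction [b]
    is absorbed in the size of [b]. *)
Definition locally_psh u p : Prop := exists2 e : R, 0 < e &
  forall q, nrm (q - p) < e ->
    {for q, continuous u} /\ forall b, nrm b < e -> submean u q b.

Lemma locally_psh_continuous u p : locally_psh u p -> {for p, continuous u}.
Proof. by case=> e e0 /(_ p)[]; rewrite ?subrr ?nrm0. Qed.

Lemma locally_psh_nbhs u p : locally_psh u p ->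
  \forall q \near p, locally_psh u q.
Proof.
case=> e e0 ue; apply/nbhs_nrmP; exists (e / 2); first by rewrite divr_gt0.
move=> q qp; exists (e / 2); first by rewrite divr_gt0.
move=> y yq; have [|cu su] := ue y.
  rewrite (le_lt_trans (_ : _ <= nrm (y - q) + nrm (q - p)))//; last by lra.
  by rewrite (le_trans _ (nrmD _ _))// addrA subrK.
by split => // b be; apply: su; lra.
Qed.

Lemma submean_near f g z b : (forall x : R[i], nrm x <= 1 ->
  f (z + x *: b) = g (z + x *: b)) -> submean f z b -> submean g z b.
Proof.
move=> fg sf e e0; apply: filterS (sf e e0) => m.
have := fg 0; rewrite nrm0 scale0r addr0 => ->; last exact: ler01.
by move/le_trans; apply; rewrite lerD2r dyadic_mean_le// => t _;
  rewrite fg// nrm_cis.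
Qed.

Lemma locally_psh_near_eq f g p : (\forall q \near p, f q = g q) ->
  locally_psh f p -> locally_psh g p.
Proof.
move=> /nbhs_nrmP[d d0 fg] [e e0 fe].
exists (Num.min e (d / 2)); first by rewrite lt_min e0 divr_gt0.
move=> q; rewrite lt_min => /andP[qe qd]; have [cf sf] := fe q qe; split.
  have fgq : \forall y \near q, f y = g y.
    apply/nbhs_nrmP; exists (d / 2); first by rewrite divr_gt0.
    move=> y yq; apply: fg.
    rewrite (le_lt_trans (_ : _ <= nrm (y - q) + nrm (q - p)))//; last by lra.
    by rewrite (le_trans _ (nrmD _ _))// addrA subrK.
  have gq : f q = g q by exact: nbhs_singleton fgq.
  apply: cvg_trans (_ : f @ q --> g q); first exact: near_eq_cvg.
  by rewrite -gq.
move=> b; rewrite lt_min => /andP[be bd]; apply: submean_near (sf b be) => x x1.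
apply: fg; rewrite addrAC (le_lt_trans (nrmD _ _))// nrmZ.
have := ler_wpM2r (nrm_ge0 b) x1; lra.
Qed.

Lemma locally_psh_comb f g h p :
  (forall q, {for q, continuous f} -> {for q, continuous g} ->
     {for q, continuous h}) ->
  (forall q b, submean f q b -> submean g q b -> submean h q b) ->
  locally_psh f p -> locally_psh g p -> locally_psh h p.
Proof.
move=> ch sh [e e0 fe] [d d0 gd].
exists (Num.min e d); first by rewrite lt_min e0.
move=> q; rewrite lt_min => /andP[/fe[cf sf] /gd[cg sg]].
split; first exact: ch.
by move=> b; rewrite lt_min => /andP[/sf fb /sg gb]; exact: sh.
Qed.

Lemma locally_pshD f g p : locally_psh f p -> locally_psh g p ->
  locally_psh (fun q => f q + g q) p.
Proof.
apply: locally_psh_comb => [q cf cg|q b sf sg e e0]; first exact: cvgD.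
have e20 : 0 < e / 2 by rewrite divr_gt0.
near=> m; rewrite dyadic_meanD.
have : f q <= dyadic_mean m (fun t => f (q + cis t *: b)) + e / 2.
  by near: m; exact: sf.
have : g q <= dyadic_mean m (fun t => g (q + cis t *: b)) + e / 2.
  by near: m; exact: sg.
lra.
Unshelve. all: by end_near. Qed.

Lemma locally_psh_max f g p :
  locally_psh f p -> locally_psh g p ->
    locally_psh (fun q => Num.max (f q) (g q)) p.
Proof.
apply: locally_psh_comb => [q cf cg|q b sf sg e e0].
  exact: continuous_max.
have [fg|gf] := leP (f q) (g q).
  apply: filterS (sg e e0) => m /le_trans; apply.
  by rewrite lerD2r dyadic_mean_le// => t _; rewrite le_max lexx orbT.
apply: filterS (sf e e0) => m /le_trans; apply.
by rewrite lerD2r dyadic_mean_le// => t _; rewrite le_max lexx.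
Qed.

Lemma locally_psh_cst c p : locally_psh (fun=> c) p.
Proof.
exists 1 => // q _; split; first exact: cvg_cst.
by move=> b _ e e0; apply: nearW => m; rewrite dyadic_mean_cst lerDl ltW.
Qed.

Lemma locally_pshZ c f p : 0 < c -> locally_psh f p ->
  locally_psh (fun q => c * f q) p.
Proof.
move=> c0 [e e0 fe]; exists e => // q /fe[cf sf]; split.
  by apply: cvgM => //; exact: cvg_cst.
move=> b /sf sb d d0; have : 0 < d / c by rewrite divr_gt0.
move/sb; apply: filterS => m.
rewrite dyadic_meanZ -(ler_pM2l c0) mulrDr => /le_trans; apply.
by rewrite lerD2l mulrC divfK// gt_eqF.
Qed.

Lemma continuous_translation w : continuous (fun q : M => q + w).
Proof. by move=> q; apply: cvgD; [exact: cvg_id|exact: cvg_cst]. Qed.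

Lemma locally_psh_translate f w p :
  locally_psh f (p + w) -> locally_psh (fun q => f (q + w)) p.
Proof.
move=> [e e0 fe]; exists e => // q qp.
have [|cf sf] := fe (q + w).
  by rewrite (_ : _ - _ = q - p)// opprD addrACA subrr addr0.
split.
  exact: cvg_comp (continuous_translation w q) cf.
move=> b /sf sb d d0; apply: filterS (sb d d0) => m /le_trans; apply.
by rewrite lerD2r dyadic_mean_le// => t _; rewrite addrAC.
Qed.

End Submean.

Section Quadratic.
Context {R : realType}.

(** Parallelogram identity, applied to antipodal nodes; this is why at least
    two nodes are required. *)
Lemma dyadic_mean_nrm2 m (x y : R[i]) :
  dyadic_mean m.+1 (fun t => nrm (x + cis t * y) ^+ 2) =
    nrm x ^+ 2 + nrm y ^+ 2.
Proof.
rewrite dyadic_meanS -[RHS](dyadic_mean_cst m); apply: dyadic_mean_eq => t.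
rewrite cisDpi mulNr.
have -> : nrm y ^+ 2 = nrm (cis (t / 2) * y) ^+ 2 by rewrite nrmM nrm_cis mul1r.
move: (cis _ * y) => {}y; rewrite !nrm_complex.
by case: x y => [a b] [c d] /=; field.
Qed.

Lemma nrm_1D_ge (x : R[i]) : nrm x <= 2^-1 -> 2^-1 <= nrm (1 + x).
Proof.
have := nrmD (1 + x) (- x); rewrite addrK nrmN.
by rewrite (nrm_real 1) normr1; lra.
Qed.

(** By induction: the terms at antipodal nodes add up to
    [ln (nrm (1 - (cis t * x) ^+ 2))], so that the sum of level [m + 1] at [x]
    is half the sum of level [m] at [- x ^+ 2].  Hence the single term left at
    level 0, which is at least [- ln 2], gets divided by [2 ^+ m]. *)
Lemma dyadic_mean_ln m (x : R[i]) : nrm x <= 2^-1 ->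
  - (2 ^+ m)^-1 * ln 2 <= dyadic_mean m (fun t => ln (nrm (1 + cis t * x))).
Proof.
elim: m x => [|m IH] x x2.
  rewrite expr0 invr1 mulN1r /dyadic_mean big_ord1 expr0 invr1 mul1r mul0r cis0
    mul1r.
  by rewrite -lnV ?posrE// ler_ln ?posrE ?nrm_1D_ge//; have := nrm_1D_ge _ x2;
    lra.
have x22 : nrm (- (x * x)) <= 2^-1.
  by rewrite nrmN nrmM; have := nrm_ge0 x; nra.
rewrite dyadic_meanS.
rewrite (@dyadic_mean_eq _ _ _
  (fun t => 2^-1 * ln (nrm (1 + cis t * - (x * x))))).
  rewrite dyadic_meanZ exprS invfM -mulrN -mulrA ler_pM2l//; exact: IH.
have nz t : 0 < nrm (1 + cis t * x).
  have : nrm (cis t * x) <= 2^-1 by rewrite nrmM nrm_cis mul1r.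
  by move/nrm_1D_ge; lra.
move=> t; rewrite mulrC; congr (_ * _); rewrite -lnM ?posrE//.
rewrite -nrmM cisDpi [in RHS](_ : t = t / 2 + t / 2); last by field.
by rewrite cisD; congr (ln (nrm _)); ring.
Qed.

End Quadratic.

(** * From small discs to all discs *)

Section LocalToGlobal.
Context {R : realType} {M : normedModType R[i]}.
Implicit Types (u : M -> R) (z b : M).

Lemma continuous_affine z b : continuous (fun x : R[i] => z + x *: b).
Proof.
move=> x P /nbhs_nrmP[e e0 eP]; have b1 := nrm_ge0 b; apply/nbhs_nrmP.
exists (e / (nrm b + 1)) => [|y]; first by rewrite divr_gt0//; lra.
rewrite ltr_pdivlMr ?(ltr_wpDl b1)// => yx; apply: eP.
rewrite opprD addrACA subrr add0r -scalerBl nrmZ (le_lt_trans _ yx)//.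
by rewrite ler_wpM2l ?nrm_ge0// lerDl.
Qed.

(** Compactness of the disc: the radius of validity of the local inequality can
    be chosen independently of the centre. *)
Lemma submean_uniform u z b :
  (forall x : R[i], nrm x <= 1 -> locally_psh u (z + x *: b)) ->
  exists2 d : R, 0 < d & forall x : R[i], nrm x <= 1 ->
    forall s, nrm s < d -> submean u (z + x *: b) s.
Proof.
move=> ub.
have : \forall d \near (0 : R)^'+, [set x : R[i] | nrm x <= 1] `<=`
    [set x | forall s, nrm s < d -> submean u (z + x *: b) s].
  apply: (compact_near_coveringP [set x : R[i] | nrm x <= 1]).1.
    exact: compact_complex_disc.
  move=> x /= /ub[e e0 ue].
  exists ([set y : R[i] | nrm ((z + y *: b) - (z + x *: b)) < e],
          [set d | d < e]).
    split => /=; last exact: nbhs_right_lt.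
    apply: (continuous_affine z b x [set q | nrm (q - (z + x *: b)) < e]).
    by apply/nbhs_nrmP; exists e.
  move=> [y d] /= [/ue[_ uy] de] s sd; apply: uy; exact: lt_trans sd de.
case=> d /= d0 H; exists (d / 2); first by rewrite divr_gt0.
move=> x x1; apply: (H (d / 2)) => //.
  by rewrite /ball_/= sub0r normrN gtr0_norm ?divr_gt0// ltr_pdivrMr//; lra.
by rewrite divr_gt0.
Qed.

Lemma dyadic_mean_exchange m n (f : R -> R -> R) :
  dyadic_mean m (fun s => dyadic_mean n (f s)) =
    dyadic_mean n (fun t => dyadic_mean m (fun s => f s t)).
Proof.
rewrite /dyadic_mean -!mulr_sumr mulrCA; congr (_ * (_ * _));
  exact: exchange_big.
Qed.

Lemma cvg_dyadic_mean {T : Type} {F : set_system T} {FF : Filter F} m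
    (f : T -> R -> R) (l : R -> R) :
  (forall t, f ^~ t @ F --> l t) ->
    (fun x => dyadic_mean m (f x)) @ F --> dyadic_mean m l.
Proof.
move=> fl; apply: cvgM; first exact: cvg_cst.
by apply: cvg_big => [|k _]; [exact: add_continuous|exact: fl].
Qed.

Lemma cvg_add_scaled_sqr {T : Type} {F : set_system T} {FF : Filter F}
    (f g : T -> R) (a b e : R) : f @ F --> a -> g @ F --> b ->
  (fun x => f x + e * g x ^+ 2) @ F --> a + e * b ^+ 2.
Proof.
move=> fa gb; apply: cvgD => //; apply: cvgM; first exact: cvg_cst.
exact: cvgM.
Qed.

(** Maximum principle for the average of [u] over the rotations of the disc by
    the [2 ^ m]-th roots of unity.  This average still satisfies the sub-mean
    value inequality on small circles, in the rotated directions.  Adding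
    [e * nrm x ^+ 2] makes the inequality strict, which excludes an interior
    maximum; and the average at the centre is [u z]. *)
Lemma rotation_mean_max u z b m (e : R) : 0 < e ->
  (forall x : R[i], nrm x <= 1 -> locally_psh u (z + x *: b)) ->
  exists2 x : R[i], nrm x = 1 &
    u z <= dyadic_mean m (fun t => u (z + (cis t * x) *: b)) + e.
Proof.
move=> e0 ub.
pose F (x : R[i]) := dyadic_mean m (fun t => u (z + (cis t * x) *: b)).
pose H x := F x + e * nrm x ^+ 2.
pose K := [set x : R[i] | nrm x <= 1].
have cH : {within K, continuous H}.
  apply: continuous_in_subspaceT => x /set_mem xK.
  have cF : F @ x --> F x.
    apply: (@cvg_dyadic_mean _ (nbhs x) _ m
      (fun y t => u (z + (cis t * y) *: b))) => t.
    pose c := cis t.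
    have cc : (fun y : R[i] => z + (c * y) *: b) @ x --> z + (c * x) *: b.
      rewrite (_ : (fun y => _) = fun y => z + y *: (c *: b)); last first.
        by apply/funext => y; rewrite scalerA mulrC.
      by rewrite mulrC -scalerA; exact: continuous_affine.
    apply: (cvg_comp _ _ cc (_ : u @ (z + (c * x) *: b) --> _)).
    by apply: locally_psh_continuous; apply: ub; rewrite nrmM nrm_cis mul1r.
  have cn : nrm @ x --> nrm x := @continuous_nrm R _ x.
  exact: (@cvg_add_scaled_sqr _ (nbhs x) _ F nrm).
have [x0] : exists2 c, c \in K & forall t, t \in K -> H t <= H c.
  apply: compact_EVT_max => //; last exact: compact_complex_disc.
  by exists 0; rewrite /K/= nrm0 ler01.
rewrite inE => x0K Hx0.
have [x01|x01] := eqVneq (nrm x0) 1.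
  exists x0 => //; have := Hx0 0; rewrite inE /K/= nrm0 ler01 => /(_ isT).
  rewrite /H nrm0 expr0n/= mulr0 addr0 x01 expr1n mulr1; apply: le_trans.
  rewrite /F (@dyadic_mean_eq _ _ _ (fun=> u z)) ?dyadic_mean_cst// => t.
  by rewrite mulr0 scale0r addr0.
exfalso; have {}x01 : nrm x0 < 1 by rewrite lt_neqAle x01.
have [d d0 ud] := submean_uniform u z b ub.
(* radius of a circle around the maximum point that stays in the disc, with
   all its rotated copies in the range of the uniform local inequality *)
pose s := Num.min (1 - nrm x0) (d / 2 / (nrm b + 1)).
have b1 : 0 < nrm b + 1 by have := nrm_ge0 b; lra.
have s0 : 0 < s by rewrite lt_min subr_gt0 x01 !divr_gt0.
have sx : s <= 1 - nrm x0 by rewrite /s ge_min lexx.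
have sb : s * nrm b < d.
  have : s <= d / 2 / (nrm b + 1) by rewrite /s ge_min lexx orbT.
  by rewrite ler_pdivlMr//; have := nrm_ge0 b; nra.
pose e' := e * s ^+ 2 / 2.
have e'0 : 0 < e' by rewrite divr_gt0// mulr_gt0// exprn_gt0.
have near_sub : \forall N \near \oo, forall k : 'I_(2 ^ m),
    u (z + (cis (k%:R * dyadic_step m) * x0) *: b) <=
    dyadic_mean N (fun t => u (z + (cis (k%:R * dyadic_step m) * x0) *: b +
      cis t *: ((cis (k%:R * dyadic_step m) * s%:C) *: b))) + e'.
  apply: filter_forall => k; apply: ud => //.
    by rewrite nrmM nrm_cis mul1r.
  by rewrite nrmZ nrmM nrm_cis mul1r nrm_real gtr0_norm.
have [[|N] [/= N0 NP]] := filter_ex (filterI (nbhs_infty_gt 0) near_sub) => //.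
have F1 : F x0 <= dyadic_mean N.+1 (fun t => F (x0 + cis t * s%:C)) + e'.
  rewrite /F dyadic_mean_exchange -[e'](dyadic_mean_cst m) -dyadic_meanD.
  rewrite /dyadic_mean ler_pM2l ?invr_gt0 ?pow2_gt0//; apply: ler_sum => k _.
  apply: le_trans (NP k) _; rewrite lerD2r /dyadic_mean.
  rewrite le_eqVlt; apply/orP; left; apply/eqP; congr (_ * _);
    apply: eq_bigr => i _.
  by rewrite -addrA scalerA -scalerDl; congr (u (_ + _ *: _)); ring.
have F2 : dyadic_mean N.+1 (fun t => F (x0 + cis t * s%:C)) +
    e * (nrm x0 ^+ 2 + s ^+ 2) <= H x0.
  rewrite -[s in X in e * X]gtr0_norm// -nrm_real.
  rewrite -(dyadic_mean_nrm2 N) -dyadic_meanZ -dyadic_meanD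
    -[leRHS](dyadic_mean_cst N.+1).
  apply: dyadic_mean_le => t _; apply: Hx0; rewrite inE /K/=.
  by rewrite (le_trans (nrmD _ _))// nrmM nrm_cis mul1r nrm_real gtr0_norm//;
    lra.
have := exprn_gt0 2 s0; move: F1 F2; rewrite /H /e'.
move: (dyadic_mean _ _) (F _) (nrm x0) => A B C; nra.
Qed.

(** Modulo rotations by roots of unity, which leave the sum invariant, [t0] is
    smaller than one step. *)
Lemma rotation_mean_osc (g : R -> R) (e : R) : continuous g ->
  (forall t, g (t + 2 * pi) = g t) -> 0 < e ->
  \forall m \near \oo, forall t0, 0 <= t0 <= 2 * pi ->
    dyadic_mean m (fun t => g (t + t0)) <= dyadic_mean m g + e.
Proof.
move=> cg gper e0.
have [d d0 gd] := @unif_continuous_segment _ g (4 * pi) cg _ e0.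
have := @near_dyadic_step R _ d0; apply: filterS => m md t0 t02.
set h := dyadic_step m in md; have h0 : 0 < h := dyadic_step_gt0 m.
have [|j1 j2] := andP (@truncn_itv _ (t0 / h) _).
  by rewrite divr_ge0 ?(ltW h0)//; lra.
set j := Num.trunc _ in j1 j2.
rewrite -(dyadic_mean_shift m g j gper) -[e](dyadic_mean_cst m) -dyadic_meanD.
apply: dyadic_mean_le => t t2;
  rewrite -lerBlDl (le_trans (ler_norm _))// ltW// gd//.
  by apply/andP; split; lra.
move: j1 j2; rewrite ler_pdivlMr// ltr_pdivrMr// -/h -natr1 => j1 j2.
by rewrite ltr_norml; apply/andP; split; lra.
Qed.

Lemma submean_global u z b :
  (forall x : R[i], nrm x <= 1 -> locally_psh u (z + x *: b)) -> submean u z b.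
Proof.
move=> ub e e0; have e20 : 0 < e / 2 by rewrite divr_gt0.
pose g t := u (z + cis t *: b).
have cg : continuous g.
  move=> t; apply: (cvg_comp cis (fun x => u (z + x *: b))
    (@continuous_cis R t)).
  apply: (cvg_comp _ _ (@continuous_affine z b (cis t))).
  by apply: locally_psh_continuous; apply: ub; rewrite nrm_cis.
have gper t : g (t + 2 * pi) = g t by rewrite /g cisD2pi.
apply: filterS (@rotation_mean_osc g _ cg gper e20) => m gm.
have [x x1] := @rotation_mean_max u z b m _ e20 ub.
have [t0 t02 ->] := cis_surj x x1.
have -> : dyadic_mean m (fun t => u (z + (cis t * cis t0) *: b)) =
          dyadic_mean m (fun t => g (t + t0)).
  by apply: dyadic_mean_eq => t; rewrite /g cisD.
by have := gm t0 t02; rewrite -/g; lra.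
Qed.

End LocalToGlobal.

(** * Plurisubharmonic functions through circle means; model functions *)

Section CircleMean.
Context {R : realType} {M : normedModType R[i]}.
Implicit Types (u : M -> R) (z b : M).

Lemma submean_circle u z b :
  (forall t, {for z + cis t *: b, continuous u}) ->
  submean u z b <->
  ((u z)%:E <= ((2 * pi)^-1)%:E *
    \int[lebesgue_measure]_(t in `[0%R, (2 * pi)%R]) (u (z + cis t *: b))%:E)%E.
Proof.
move=> cu.
have cg : continuous (fun t => u (z + cis t *: b)).
  move=> t; apply: (cvg_comp cis (fun x => u (z + x *: b))
    (@continuous_cis R t)).
  exact: (cvg_comp _ _ (@continuous_affine R M z b (cis t)) (cu t)).
have [l [dl ->]] := dyadic_mean_cvg _ cg.
rewrite -EFinM lee_fin mulrA mulVf ?mul1r;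
  last by rewrite gt_eqF// mulr_gt0 ?pi_gt0.
split => [sub|ul e e0].
  apply/ler_addgt0Pr => e e0; have e20 : 0 < e / 2 by rewrite divr_gt0.
  move/cvgrPdist_le : dl => /(_ _ e20) => dl.
  have [m [/= um]] := filter_ex (filterI (sub _ e20) dl).
  by rewrite ler_distlC => /andP[lm ml]; lra.
move/cvgrPdist_le : dl => /(_ e e0); apply: filterS => m.
by rewrite ler_distlC => /andP[lm ml]; lra.
Qed.

End CircleMean.

Section Plurisubharmonic.
Context {R : realType} {n : nat}.
Local Notation V := 'rV[R[i]]_n.
Implicit Types (u : V -> R) (p : V) (D : set V).

Lemma circle_point (a b : V) (c : R[i]) (r t : R) :
  a + (c + r%:C * (cos t +i* sin t)) *: b = a + c *: b + cis t *: (r%:C *: b).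
Proof. by rewrite scalerDl addrA scalerA [cis t * _]mulrC. Qed.

(** Only discs centred at 0 with radius 1 in the slice parameter are needed,
    since the direction [b] ranges over a neighbourhood of 0. *)
Lemma locally_psh_of_psh u D p : open D -> (forall q, D q ->
  {for q, continuous u}) ->
  plurisubharmonic_on D (EFin \o u) -> D p -> locally_psh u p.
Proof.
move=> oD cu [_ _ sD] Dp.
have /nbhs_nrmP[e e0 eD] : nbhs p D by exact: open_nbhs_nbhs.
exists (e / 2); first by rewrite divr_gt0.
move=> q qe; split; first by apply: cu; apply: eD; lra.
move=> b be.
have Dx (x : R[i]) : nrm x <= 1 -> D (q + x *: b).
  move=> x1; apply: eD; rewrite addrAC (le_lt_trans (nrmD _ _))// nrmZ.
  have := ler_wpM2r (nrm_ge0 b) x1; lra.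
apply/submean_circle => [t|]; first by apply/cu/Dx; rewrite nrm_cis.
have [_ _ /(_ 0 1 ltr01)] := sD q b.
rewrite /circle_mean/= scale0r addr0.
under eq_integral do rewrite circle_point scale0r addr0 scale1r.
apply => x /=; rewrite subr0 nrmE lecR; exact: Dx.
Qed.

Lemma continuous_usc (T : topologicalType) (f : T -> R) (A : set T) :
  (forall x, A x -> {for x, continuous f}) -> usc_on A (EFin \o f).
Proof.
move=> cf x Ax a; rewrite /= lte_fin => fxa.
rewrite near_withinE; have fa : \forall y \near x, f y < a.
  exact: (@cvgr_lt _ _ (nbhs x) _ _ _ (cf x Ax) _ fxa).
by apply: filterS fa => y fya _; rewrite lte_fin.
Qed.

Lemma psh_of_locally_psh u D : (forall p, D p -> locally_psh u p) ->
  plurisubharmonic_on D (EFin \o u).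
Proof.
move=> uD; have cu p : D p -> {for p, continuous u}.
  by move=> /uD; exact: locally_psh_continuous.
split => [z _||a b]; [by rewrite ltry|exact: continuous_usc|].
split => [x _||c r r0 disc]; first by rewrite ltry.
  apply: (@continuous_usc R[i] (fun x => u (a + x *: b))
    [set x | D (a + x *: b)]) => x Dx.
  exact: (cvg_comp _ _ (@continuous_affine _ _ a b x) (cu _ Dx)).
have Dx (x : R[i]) : nrm x <= 1 -> D (a + c *: b + x *: (r%:C *: b)).
  move=> x1; rewrite -addrA scalerA -scalerDl; apply: disc => /=.
  by rewrite addrAC subrr add0r nrmE nrmM nrm_real lecR gtr0_norm// ger_pMl.
rewrite /circle_mean/=; under eq_integral do rewrite circle_point.
apply/submean_circle => [t|]; first by apply: cu; apply: Dx; rewrite nrm_cis.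
by apply: submean_global => x /Dx /uD.
Qed.

Lemma nrm_coord (v : V) i : nrm (v ord0 i) <= nrm v.
Proof.
rewrite -lecR -!nrmE [leRHS]/Num.norm/= mx_normE -[leLHS]nngE num_le.
exact: (le_bigmax _ (fun ij : 'I_1 * 'I_n => `|v ij.1 ij.2|%:nng) (ord0, i)).
Qed.

Lemma nrm_coord_attained (v : V) : v != 0 -> exists i, nrm v = nrm (v ord0 i).
Proof.
rewrite -normr_eq0 => /mx_norm_neq0[[j i] /= vij]; exists i.
by rewrite /nrm [in LHS]/Num.norm/= vij (ord1 j).
Qed.

(** For the supremum norm, [ln (nrm v)] is the maximum of the functions
    [ln (nrm (v ord0 i))].  At a given point it is enough to bound the mean from
    below by that of one coordinate realising the maximum, which is a
    one-dimensional estimate. *)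
Lemma locally_psh_ln_nrm (a p : V) : p != a ->
  locally_psh (fun q => ln (nrm (q - a))) p.
Proof.
rewrite -subr_eq0 -nrm_gt0 => r0; set r := nrm (p - a) in r0.
exists (r / 4); first by rewrite divr_gt0.
move=> q qp.
have qr : 3 / 4 * r < nrm (q - a).
  have := nrmD (p - q) (q - a); rewrite addrA subrK (nrmC p q) -/r; lra.
have qa0 : 0 < nrm (q - a) by lra.
split.
  have ca := @continuous_translation _ _ (- a) q.
  have cn : nrm @ (q - a) --> nrm (q - a) by exact: continuous_nrm.
  exact: (cvg_comp _ _ (cvg_comp _ _ ca cn) (continuous_ln qa0)).
move=> b br; set v := q - a in qr qa0 *.
have [|i vi] := nrm_coord_attained v; first by rewrite -nrm_gt0.
have vi0 : v ord0 i != 0 by rewrite -nrm_gt0 -vi.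
pose x := b ord0 i / v ord0 i.
have x2 : nrm x <= 2^-1.
  have : nrm x * nrm v = nrm (b ord0 i) by rewrite vi -nrmM divfK.
  have := nrm_coord b i; have := nrm_ge0 x; nra.
move=> e e0; apply: filterS (@near_dyadic_step R e e0) => m me.
have ln2 : (2 ^+ m)^-1 * ln (2 : R) <= dyadic_step m.
  rewrite /dyadic_step (mulrC (2 * pi)) ler_pM2l ?invr_gt0 ?pow2_gt0//.
  have := @ln_sublinear R 2 (ltr0n _ _); have := @pi_ge2 R; lra.
have := @dyadic_mean_ln R m x x2; rewrite mulNr => dx.
suff : ln (nrm v) + dyadic_mean m (fun t => ln (nrm (1 + cis t * x))) <=
    dyadic_mean m (fun t => ln (nrm (q + cis t *: b - a))) by lra.
rewrite -[ln (nrm v)](dyadic_mean_cst m) -dyadic_meanD;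
  apply: dyadic_mean_le => t _.
have x1 : 0 < nrm (1 + cis t * x).
  have /nrm_1D_ge : nrm (cis t * x) <= 2^-1 by rewrite nrmM nrm_cis mul1r.
  lra.
have vx : nrm v * nrm (1 + cis t * x) <= nrm (q + cis t *: b - a).
  rewrite vi -nrmM mulrDr mulr1 mulrCA [v _ _ * x]mulrC divfK//.
  rewrite (_ : q + _ - a = v + cis t *: b); last by rewrite addrAC.
  by rewrite (le_trans _ (nrm_coord _ i))// !mxE.
have v0 : 0 < nrm v * nrm (1 + cis t * x) by rewrite mulr_gt0.
by rewrite -lnM ?posrE// ler_ln ?posrE// (lt_le_trans v0).
Qed.

(** The squared Euclidean norm, which unlike the supremum norm has exactly
    computable circle means. *)
Definition esq (v : V) : R := \sum_(i < n) nrm (v ord0 i) ^+ 2.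

Lemma esq_ge0 v : 0 <= esq v.
Proof. by apply: sumr_ge0 => i _; rewrite exprn_ge0// nrm_ge0. Qed.

Lemma esq0 : esq 0 = 0.
Proof. by rewrite /esq big1// => i _; rewrite mxE nrm0 expr0n. Qed.

Lemma cvg_sum_ord {T : Type} {F : set_system T} {FF : Filter F}
    (f : 'I_n -> T -> R) (l : 'I_n -> R) : (forall i, f i @ F --> l i) ->
  (fun x => \sum_(i < n) f i x) @ F --> \sum_(i < n) l i.
Proof. by move=> fl; apply: cvg_big => // ; exact: add_continuous. Qed.

Lemma continuous_esq : continuous esq.
Proof.
move=> p.
apply: (@cvg_sum_ord V (nbhs p) _ (fun i v => nrm (v ord0 i) ^+ 2)) => i.
have cp : (fun v : V => nrm (v ord0 i)) @ p --> nrm (p ord0 i).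
  exact: (cvg_comp _ _ (@coord_continuous _ _ _ ord0 i p) (@continuous_nrm _ _
    _)).
exact: (@cvgM _ _ (nbhs p)).
Qed.

Lemma nrm_esq v : nrm v ^+ 2 <= esq v.
Proof.
have [->|v0] := eqVneq v 0; first by rewrite nrm0 expr0n esq_ge0.
have [i ->] := nrm_coord_attained v v0.
rewrite /esq (bigD1 i)//= lerDl; apply: sumr_ge0 => j _.
by rewrite exprn_ge0// nrm_ge0.
Qed.

Lemma dyadic_mean_esq m v b :
  dyadic_mean m.+1 (fun t => esq (v + cis t *: b)) = esq v + esq b.
Proof.
rewrite /dyadic_mean exchange_big/= mulr_sumr -big_split/=;
  apply: eq_bigr => i _.
by rewrite -(dyadic_mean_nrm2 m); congr (_ * _); apply: eq_bigr => k _;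
  rewrite !mxE.
Qed.

Lemma submean_esq v b : submean esq v b.
Proof.
move=> e e0; apply: filterS (nbhs_infty_gt 0) => -[//|m] _.
by rewrite dyadic_mean_esq; have := esq_ge0 b; lra.
Qed.

Lemma locally_psh_esq p : locally_psh esq p.
Proof.
exists 1 => // q _; split; first exact: continuous_esq.
by move=> b _; exact: submean_esq.
Qed.

(** This difference is the real part of an affine holomorphic function, and
    indeed the contributions of the radius cancel in the means. *)
Lemma locally_psh_esq_diff z p : locally_psh (fun q => esq q - esq (q - z)) p.
Proof.
exists 1 => // q _; split.
  have cz := cvg_comp _ _ (@continuous_translation _ _ (- z) q)
    (@continuous_esq _).
  exact: (@cvgB _ _ _ (nbhs q) _ _ _ _ _ (@continuous_esq q) cz).
move=> b _ e e0; apply: filterS (nbhs_infty_gt 0) => -[//|m] _.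
rewrite (@dyadic_mean_eq _ _ _ (fun t => esq (q + cis t *: b) +
    -1 * esq (q - z + cis t *: b))).
  by rewrite dyadic_meanD dyadic_meanZ !dyadic_mean_esq; lra.
by move=> t; rewrite addrAC mulN1r.
Qed.

End Plurisubharmonic.

(** * Gluing two functions by a maximum in a shell *)
Section MaxGlue.
Context {R : realType}.

Definition maxglue {T : Type} (rho : T -> R) (a b : R)
    (f g : T -> R) (p : T) : R :=
  if rho p < a then g p else if b < rho p then f p else Num.max (f p) (g p).

Section NearMaxGlue.
Context {T : Type} (rho f g : T ->
  R) (a b : R) {F : set_system T} {FF : Filter F}.

Lemma maxglue_near_inner r : rho @ F --> r -> r < a ->
  \forall p \near F, g p = maxglue rho a b f g p.
Proof.
by move=> /cvgr_lt /[apply]; apply: filterS => p; rewrite /maxglue => ->.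
Qed.

Lemma maxglue_near_outer r : a < b -> rho @ F --> r -> b < r ->
  \forall p \near F, f p = maxglue rho a b f g p.
Proof.
move=> ab /cvgr_gt /[apply]; apply: filterS => p bp.
by rewrite /maxglue bp ltNge (ltW (lt_trans ab bp)).
Qed.

(** Strict inequalities on the two spheres propagate to neighbouring points by
    continuity, so that the pieces agree with the maximum just inside the inner
    sphere and just outside the outer one. *)
Lemma maxglue_near_middle r s t : a < b -> rho @ F --> r -> f @ F --> s ->
  g @ F --> t ->
  a <= r <= b -> (r = a -> s < t) -> (r = b -> t < s) ->
  \forall p \near F, Num.max (f p) (g p) = maxglue rho a b f g p.
Proof.
move=> ab rr fs gt /andP[ar rb] sa tb.
have low : \forall p \near F, rho p < a -> f p <= g p.
  move: ar; rewrite le_eqVlt => /predU1P[/esym/sa st|ar].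
    have d0 : 0 < t - s by rewrite subr_gt0.
    have : \forall p \near F, 0 < g p - f p by exact: cvgr_gt (cvgB gt fs) _ d0.
    by apply: filterS => p; rewrite subr_gt0 => /ltW.
  by apply: filterS (cvgr_gt _ rr _ ar) => p /lt_trans h /h; rewrite ltxx.
have high : \forall p \near F, b < rho p -> g p <= f p.
  move: rb; rewrite le_eqVlt => /predU1P[/tb ts|rb].
    have d0 : 0 < s - t by rewrite subr_gt0.
    have : \forall p \near F, 0 < f p - g p by exact: cvgr_gt (cvgB fs gt) _ d0.
    by apply: filterS => p; rewrite subr_gt0 => /ltW.
  by apply: filterS (cvgr_lt _ rr _ rb) => p h /lt_trans /(_ h); rewrite ltxx.
apply: filterS2 low high => p lp hp; rewrite /maxglue.
case: ifPn => [/lp/max_r//|_]; case: ifPn => [/hp/max_l//|//].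
Qed.

End NearMaxGlue.

Context {M : normedModType R[i]}.
Context (rho f g : M -> R) (a b : R) (ab : a < b) (crho : continuous rho).

Lemma locally_psh_maxglue p : (a <= rho p -> locally_psh f p) ->
  (rho p <= b -> locally_psh g p) ->
  (rho p = a -> f p < g p) -> (rho p = b -> g p < f p) ->
  locally_psh (maxglue rho a b f g) p.
Proof.
move=> fp gp fa gb.
have [pa|ap] := ltP (rho p) a.
  apply: locally_psh_near_eq (gp _); last by rewrite ltW// (lt_trans pa).
  exact: maxglue_near_inner (crho p) pa.
have [bp|pb] := ltP b (rho p).
  exact: locally_psh_near_eq (maxglue_near_outer _ _ _ _ _ _ ab (crho p) bp)
    (fp ap).
have pf := fp ap; have cf := locally_psh_continuous _ _ pf.
have pg := gp pb; have cg := locally_psh_continuous _ _ pg.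
apply: locally_psh_near_eq (locally_psh_max _ _ _ pf pg).
by apply: (maxglue_near_middle _ _ _ _ _ _ _ _ ab (crho p) cf cg) => //;
  rewrite ap.
Qed.

Lemma within_continuous_maxglue (X : set M) :
  (forall p, X p -> a <= rho p -> f @ within X (nbhs p) --> f p) ->
  (forall p, X p -> rho p <= b -> g @ within X (nbhs p) --> g p) ->
  (forall p, X p -> rho p = a -> f p < g p) ->
  (forall p, X p -> rho p = b -> g p < f p) ->
  forall p, X p ->
    maxglue rho a b f g @ within X (nbhs p) --> maxglue rho a b f g p.
Proof.
move=> cf cg fa gb p Xp; set W := within X (nbhs p).
have cr : rho @ W --> rho p by apply: cvg_within_filter; exact: crho.
have [pa|ap] := ltP (rho p) a.
  rewrite [X in _ --> X]/maxglue pa.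
  apply: cvg_trans (cg p Xp _); last by rewrite ltW// (lt_trans pa).
  by apply: near_eq_cvg; exact: maxglue_near_inner cr pa.
have [bp|pb] := ltP b (rho p).
  rewrite [X in _ --> X]/maxglue bp ltNge ap/=.
  apply: cvg_trans (cf p Xp ap).
  by apply: near_eq_cvg; exact: maxglue_near_outer ab cr bp.
rewrite [X in _ --> X]/maxglue !ltNge ap pb/=.
have cfp := cf p Xp ap; have cgp := cg p Xp pb.
apply: cvg_trans (_ : (fun q => Num.max (f q) (g q)) @ W --> _).
  apply: near_eq_cvg.
  by apply: (maxglue_near_middle _ _ _ _ _ _ _ _ ab cr cfp cgp);
    rewrite ?ap//; auto.
exact: (cvg_comp2 cfp cgp (@max_continuous _ R (f p, g p))).
Qed.

End MaxGlue.

(** * Extending the domain of plurisubharmonicity *)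

(** Induction over the subsets of a compact set: a property of sets that holds
    locally and is stable under unions and subsets holds for the compact set,
    being inherited from a finite subcover. *)
Lemma compact_set_ind (T : topologicalType) (X : set T) (Q : set T -> Prop) :
  compact X -> Q set0 -> (forall A B, Q A -> Q B -> Q (A `|` B)) ->
  (forall A B, A `<=` B -> Q B -> Q A) ->
  (forall x, X x -> exists2 N, nbhs x N & Q N) -> Q X.
Proof.
move=> cX Q0 QU Qsub Qloc.
pose F : set_system (set T) :=
  [set P | exists2 A, Q A & forall B, A `<=` B -> P B].
have FF : Filter F.
  split; first by exists set0.
    move=> P P' [A QA AP] [A' QA' AP']; exists (A `|` A'); first exact: QU.
    by move=> B; rewrite subUset => -[AB A'B]; split; [exact: AP|exact: AP'].
  by move=> P P' PP' [A QA AP]; exists A => // B AB; exact/PP'/AP.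
have : \forall B \near F, X `<=` B.
  apply: ((compact_near_coveringP X).1 cX) => x /Qloc[N xN QN].
  exists (N, [set B | N `<=` B]) => /=; first by split => //; exists N.
  by move=> [y B] [/= Ny NB]; exact: NB.
by case=> A QA /(_ A (@subset_refl _ A)) XA; exact: Qsub XA QA.
Qed.

Section Approximation.
Context {R : realType} {n : nat}.
Local Notation V := 'rV[R[i]]_n.
Context (Omega : set V) (M : R).
Local Notation X := (closure Omega).
Context (XM : forall p, X p -> nrm p <= M).
Implicit Types (u v : V -> R) (p q a z : V).

(** The invariant of the construction. *)
Definition admissible v : Prop :=
  (forall p, X p -> v @ within X (nbhs p) --> v p) /\
  forall p, Omega p -> locally_psh v p.

Definition improves v (d : R) v' : Prop :=
  [/\ admissible v', forall p, X p -> `|v' p - v p| <= d &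
      forall p, X p -> locally_psh v p -> locally_psh v' p].

Lemma improves_refl v d : 0 <= d -> admissible v -> improves v d v.
Proof. by move=> d0 av; split => // p _; rewrite subrr normr0. Qed.

Lemma improves_trans v v' v'' d d' :
  improves v d v' -> improves v' d' v'' -> improves v (d + d') v''.
Proof.
move=> [_ vd vp] [av'' vd' vp']; split => // p Xp.
  have := vd p Xp; have := vd' p Xp => h h'.
  by rewrite (le_trans (ler_distD (v' p) _ _))// addrC lerD.
by move=> /(vp _ Xp)/(vp' _ Xp).
Qed.

Lemma cvg_sub_near v p (e : R) : admissible v -> X p -> 0 < e ->
  exists2 r, 0 < r & forall q, X q -> nrm (q - p) < r -> `|v q - v p| < e.
Proof.
move=> [cv _] Xp e0; have /cvgrPdist_lt /(_ e e0) := cv p Xp.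
move=> /nbhs_nrmP[r r0 rv]; exists r => // q Xq qp.
by rewrite distrC; exact: rv.
Qed.

(** The gluing of [v + k * ln (nrm (q - a))] with a constant.  The factor [k] is
    chosen so that the absolute value of this perturbation is at most [e] from
    the outer radius [r] up to a bound [B] for the distances to [a], and then
    the inner radius [s] so that the perturbation is at most [- 6 * e] there; the
    constant [v a - 4 * e] fits between. *)
Lemma extend_over_point a v d : X a -> admissible v -> 0 < d ->
  exists2 v', improves v d v' & locally_psh v' a.
Proof.
move=> Xa av d0; pose e := d / 5; have e0 : 0 < e by rewrite divr_gt0.
have [r0 r00 vr0] := cvg_sub_near v a e av Xa e0.
pose r := r0 / 2; have rp : 0 < r by rewrite divr_gt0.
pose B := 2 * `|M| + r + 1.
have B0 : 0 < B by rewrite /B; have := normr_ge0 M; lra.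
have XB q : X q -> nrm (q - a) <= B.
  move=> /XM qM; have := XM _ Xa; have := nrmD q (- a); rewrite nrmN.
  by have := ler_norm M; rewrite /B; lra.
pose L := `|ln r| + `|ln B| + 1.
have L0 : 0 < L by rewrite /L; have := normr_ge0 (ln r);
  have := normr_ge0 (ln B); lra.
pose k := e / L; have k0 : 0 < k by rewrite divr_gt0.
have kL : k * L = e by rewrite divfK ?gt_eqF.
have kln x : r <= x -> x <= B -> - e <= k * ln x <= e.
  move=> rx xB; have x0 : 0 < x := lt_le_trans rp rx.
  have : ln r <= ln x by rewrite ler_ln ?posrE.
  have : ln x <= ln B by rewrite ler_ln ?posrE.
  have := ler_norm (- ln r); have := ler_norm (ln B); rewrite normrN.
  move: (normr_ge0 (ln r)) (normr_ge0 (ln B)).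
  have -> : e = k * L by []. rewrite -mulrN !ler_pM2l// /L => *; apply/andP;
    split; lra.
(* chosen so that [k * ln s <= - 6 * (k * L) = - 6 * e] *)
pose s := Num.min (r / 2) (expR (- 6 * L)).
have s0 : 0 < s by rewrite lt_min divr_gt0//= expR_gt0.
have sr : s < r by rewrite /s gt_min ltr_pdivrMr//; apply/orP; left; lra.
have ks : k * ln s <= - 6 * e.
  rewrite -kL mulrCA ler_pM2l// -[leRHS]expRK ler_ln ?posrE ?expR_gt0//.
  by rewrite /s ge_min lexx orbT.
pose f q := v q + k * ln (nrm (q - a)).
pose c := v a - 4 * e.
have cra : continuous (fun q => nrm (q - a)).
  move=> q; exact: (cvg_comp _ _ (@continuous_translation _ _ (- a) q)
                      (@continuous_nrm _ _ (q - a))).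
have va q : X q -> nrm (q - a) <= r -> `|v q - v a| < e.
  by move=> Xq qr; apply: vr0 => //; rewrite (le_lt_trans qr)// /r; lra.
have fs q : X q -> nrm (q - a) = s -> f q < c.
  move=> Xq qs; have := va q Xq; rewrite qs (ltW sr) => /(_ isT).
  by rewrite ltr_norml /f /c qs => /andP[_]; lra.
have fr q : X q -> nrm (q - a) = r -> c < f q.
  move=> Xq qr; have := va q Xq; rewrite qr lexx => /(_ isT).
  have := kln r (lexx _); rewrite -{1}qr XB// => /(_ isT)/andP[kr _].
  by rewrite ltr_norml /f /c qr => /andP[+ _]; lra.
have neq q : s <= nrm (q - a) -> q != a.
  by move=> sq; rewrite -subr_eq0 -nrm_gt0; exact: lt_le_trans s0 sq.
have pf q : X q -> locally_psh v q ->
  locally_psh (maxglue (fun q => nrm (q - a)) s r f (fun=> c)) q.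
  move=> Xq vq; apply: locally_psh_maxglue => //.
  - move=> /neq qa; apply: locally_pshD => //; apply: locally_pshZ => //;
    exact: locally_psh_ln_nrm.
  - by move=> _; exact: locally_psh_cst.
  - exact: fs.
  - exact: fr.
have [cv vO] := av.
exists (maxglue (fun q => nrm (q - a)) s r f (fun=> c)); last first.
  apply: locally_psh_maxglue; rewrite ?subrr ?nrm0//.
  - by rewrite leNgt s0.
  - by move=> _; exact: locally_psh_cst.
  - by move=> s0'; rewrite s0' ltxx in s0.
  - by move=> r0'; rewrite r0' ltxx in rp.
split => //.
- split; last by move=> p Op; apply: pf; [exact: subset_closure|exact: vO].
  apply: within_continuous_maxglue => //.
  + move=> p Xp /neq pa; apply: cvgD; first exact: cv.
    apply: cvg_within_filter.
    exact: locally_psh_continuous (locally_pshZ k _ _ k0 (locally_psh_ln_nrm a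
      p pa)).
  + by move=> p _ _; exact: cvg_cst.
- move=> q Xq; rewrite ler_distl /maxglue.
  have d5 : d = 5 * e by rewrite mulrC divfK.
  have [qs|sq] := ltP (nrm (q - a)) s.
    have := va q Xq (ltW (lt_trans qs sr));
      rewrite ltr_norml /c => /andP[h1 h2].
    by apply/andP; split; lra.
  have [rq|qr] := ltP r (nrm (q - a)).
    have /andP[k1 k2] := kln _ (ltW rq) (XB q Xq).
    by rewrite /f; apply/andP; split; lra.
  have := va q Xq qr; rewrite ltr_norml => /andP[h1 h2].
  have klnq : k * ln (nrm (q - a)) <= e.
    have rB : r <= B by rewrite /B; have := normr_ge0 M; lra.
    have /andP[_] := kln r (lexx r) rB; apply: le_trans.
    by rewrite ler_pM2l// ler_ln ?posrE// (lt_le_trans s0).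
  rewrite le_max ge_max /f /c; apply/andP; split.
    by apply/orP; right; lra.
  by apply/andP; split; lra.
Qed.

Lemma esq_le p : nrm p <= M -> esq p <= n%:R * M ^+ 2.
Proof.
move=> pM; rewrite (@le_trans _ _ (\sum_(i < n) M ^+ 2))//; last first.
  by rewrite sumr_const card_ord mulr_natl.
apply: ler_sum => i _; have := le_trans (nrm_coord p i) pM.
by have := nrm_ge0 (p ord0 i); move: (nrm _) => x *;
  rewrite ler_pXn2r// nnegrE; lra.
Qed.

Lemma compact_closure_nrm : compact X.
Proof.
apply: (subclosed_compact _ (@rV_compact R[i] n (fun=> [set x | nrm x <=
  M]) _)).
- exact: closed_closure.
- by move=> _; exact: compact_complex_disc.
- by move=> p /XM pM i /=; rewrite (le_trans (nrm_coord p i)).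
Qed.

(** Uniform continuity on the compact closure, used along a segment direction
    that keeps the translated points in [Omega]. *)
Lemma small_translation v w z (b e : R) : admissible v -> 0 < e ->
  (forall (t : R) q, 0 < t < 1 -> X q -> esq (q - z) <= b ->
     Omega (q + t%:C *: w)) ->
  exists2 t : R, 0 < t < 1 &
    forall q, X q -> esq (q - z) <= b -> `|v (q + t%:C *: w) - v q| < e.
Proof.
move=> av e0 Ow.
have e20 : 0 < e / 2 by rewrite divr_gt0.
have : \forall t \near (0 : R)^'+, X `<=` [set q | 0 < t -> t < 1 -> X q ->
    esq (q - z) <= b -> `|v (q + t%:C *: w) - v q| < e].
  apply: ((compact_near_coveringP X).1 compact_closure_nrm) => q Xq.
  have [r r0 rv] := cvg_sub_near v q _ av Xq e20.
  have w1 : 0 < nrm w + 1 by have := nrm_ge0 w; lra.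
  pose s := r / 2 / (nrm w + 1).
  have s0 : 0 < s by rewrite !divr_gt0.
  exists ([set q' | nrm (q' - q) < r / 2], [set t | t < s]).
    split => /=; last exact: nbhs_right_lt.
    by apply/nbhs_nrmP; exists (r / 2) => //; rewrite divr_gt0.
  move=> [q' t] /= [qq' ts] t0 t1 Xq' q'b.
  rewrite (le_lt_trans (ler_distD (v q) _ _))// [e]splitr ltrD//.
    apply: rv; first by apply: subset_closure; apply: Ow; rewrite ?t0.
    rewrite addrAC (le_lt_trans (nrmD _ _))// nrmZ nrm_real gtr0_norm//.
    have : t * (nrm w + 1) < r / 2 by rewrite -ltr_pdivlMr.
    by move: (nrm_ge0 w); lra.
  by rewrite distrC; apply: rv => //; lra.
move=> Ht; have H1 : \forall t \near (0 : R)^'+, t < 1 by exact: nbhs_right_lt.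
have [t [[Ht' t1] /= t0]] :=
  filter_ex (filterI (filterI Ht H1) (nbhs_right_gt 0)).
by exists t => [|q Xq]; [rewrite t0|exact: Ht'].
Qed.

(** The order of quantifiers matters: the neighbourhood is fixed by the Segment
    Property alone, so finitely many of them can be selected before the
    accuracy is known. *)
Lemma extend_near_C0 z : C0_boundary_point Omega z ->
  exists2 N, nbhs z N & forall v d, admissible v -> 0 < d ->
    exists2 v', improves v d v' & forall p, X p -> N p -> locally_psh v' p.
Proof.
move=> [_ [U [w [/nbhs_nrmP[r r0 rU] Uw]]]].
pose b := (r / 2) ^+ 2; have b0 : 0 < b by rewrite exprn_gt0// divr_gt0.
have ab : b / 2 < b by lra.
have bU q : esq (q - z) <= b -> U q.
  move=> qb; apply: rU; have := le_trans (nrm_esq _) qb.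
  by rewrite /b; have := nrm_ge0 (q - z); nra.
have Ow (t : R) q : 0 < t < 1 -> X q -> esq (q - z) <= b ->
  Omega (q + t%:C *: w).
  by move=> t01 Xq qb; apply: Uw t01 _ _; exists q => //; split => //;
    exact: bU.
have crz : continuous (fun q => esq (q - z)).
  move=> q; exact: (cvg_comp _ _ (@continuous_translation _ _ (- z) q)
                      (@continuous_esq _ _ (q - z))).
exists [set q | esq (q - z) < b / 2].
  apply: (@cvgr_lt _ _ (nbhs z) _ _ _ (crz z)).
  by rewrite subrr esq0 divr_gt0.
move=> v d av d0; pose B := n%:R * M ^+ 2.
have B0 : 0 <= B by rewrite mulr_ge0// sqr_ge0.
have XB q : X q -> 0 <= esq q <= B by move=> /XM/esq_le ->; rewrite esq_ge0.
(* the total perturbation is at most [k * (B + 2 * b)], while the gap between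
   the two functions on either sphere is [k * b / 4] *)
pose k := d / (B + 2 * b).
have k0 : 0 < k by rewrite divr_gt0//; lra.
have kd : k * (B + 2 * b) = d by rewrite divfK// gt_eqF//; lra.
have kb0 : 0 < k * b / 4 by rewrite divr_gt0// mulr_gt0.
have [t t01 vt] := small_translation v w z b _ av kb0 Ow.
pose f q := v q + k * esq q.
pose g q := v (q + t%:C *: w) + k * ((esq q - esq (q - z)) + 3 * b / 4).
have pg q : X q -> esq (q - z) <= b -> locally_psh g q.
  move=> Xq qb; apply: locally_pshD.
    by apply: locally_psh_translate; apply: av.2; exact: Ow.
  apply: locally_pshZ => //; apply: locally_pshD;
    first exact: locally_psh_esq_diff.
  exact: locally_psh_cst.
have pf q : locally_psh v q -> locally_psh f q.
  by move=> vq; apply: locally_pshD => //; apply: locally_pshZ => //;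
    exact: locally_psh_esq.
have fg q : X q -> esq (q - z) = b / 2 -> f q < g q.
  move=> Xq qa; have := vt q Xq; rewrite /f /g qa => /(_ (ltW ab)).
  by rewrite ltr_norml => /andP[]; lra.
have gf q : X q -> esq (q - z) = b -> g q < f q.
  move=> Xq qa; have := vt q Xq; rewrite /f /g qa => /(_ (lexx _)).
  by rewrite ltr_norml => /andP[]; lra.
pose h := maxglue (fun q => esq (q - z)) (b / 2) b f g.
have ph q : X q -> locally_psh v q -> locally_psh h q.
  by move=> Xq vq; apply: locally_psh_maxglue => // *;
    [exact: pf|exact: pg|exact: fg|exact: gf].
exists h; last first.
  move=> q Xq /= qa; apply: locally_psh_maxglue => //.
  - by rewrite leNgt qa.
  - exact: pg.
  - exact: fg.
  - exact: gf.
split => //.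
- split; last by move=> p Op; apply: ph; [exact: subset_closure|exact: av.2].
  apply: within_continuous_maxglue => //.
  + move=> p Xp _; apply: cvgD; first exact: av.1.
    apply: cvg_within_filter.
    exact: locally_psh_continuous (locally_pshZ k _ _ k0 (locally_psh_esq p)).
  + move=> p Xp pb; apply: cvg_within_filter.
    exact: locally_psh_continuous (pg p Xp pb).
- move=> q Xq; rewrite ler_distl /h /maxglue.
  have /andP[q0 qB] := XB q Xq.
  have kq0 : 0 <= k * esq q by rewrite mulr_ge0// ltW.
  have kqB : k * esq q <= k * B by rewrite ler_pM2l.
  have kb : 0 < k * b by rewrite mulr_gt0.
  have kdE : k * B + 2 * (k * b) = d by rewrite -kd; ring.
  have fd : v q - d <= f q <= v q + d.
    by rewrite /f; apply/andP; split; lra.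
  have gd : esq (q - z) <= b -> v q - d <= g q <= v q + d.
    move=> qb; have := vt q Xq qb; rewrite ltr_norml => /andP[v1 v2].
    have kz0 : 0 <= k * esq (q - z) by rewrite mulr_ge0 ?esq_ge0// ltW.
    have kzb : k * esq (q - z) <= k * b by rewrite ler_pM2l.
    rewrite /g mulrDr mulrBr; apply/andP; split; lra.
  have [qa|aq] := ltP (esq (q - z)) (b / 2); first by apply: gd; lra.
  have [bq|qb] := ltP b (esq (q - z)); first exact: fd.
  have /andP[g1 g2] := gd qb; have /andP[f1 f2] := fd.
  by rewrite le_max f1 ge_max f2 g2.
Qed.

Context (openO : open Omega) (K : set V) (Kcount : countable K) (KX : K `<=` X).
Context (OC0 : forall z,
  (boundary Omega `\` K) z -> C0_boundary_point Omega z).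

(** The [k]-th step treats the point of index [k] with accuracy
    [d / 2 ^+ k.+1], so that the accumulated error after [k] steps is
    [d * (1 - (2 ^+ k)^-1)]. *)
Lemma extend_over_countable u d : admissible u -> 0 < d ->
  exists w : nat -> V -> R, [/\ forall k, improves u d (w k),
    forall k l p, (k <= l)%N -> X p -> locally_psh (w k) p ->
      locally_psh (w l) p &
    forall p, K p -> exists k, locally_psh (w k) p].
Proof.
move=> au d0; have [f finj] := countable_injP _ Kcount.
have d2 k : 0 < d / 2 ^+ k.+1 by rewrite divr_gt0// exprn_gt0.
have step (kv : nat * (V -> R)) : exists v', admissible kv.2 ->
    improves kv.2 (d / 2 ^+ kv.1.+1) v' /\
    forall p, K p -> f p = kv.1 -> locally_psh v' p.
  have [av|nav] := pselect (admissible kv.2); last by exists kv.2.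
  have [[p [Kp fp]]|nop] := pselect (exists p, K p /\ f p = kv.1).
    have [v' vv' v'p] := extend_over_point p kv.2 _ (KX _ Kp) av (d2 kv.1).
    exists v' => _; split => // q Kq fq.
    by rewrite (finj q p) ?inE// fq fp.
  exists kv.2 => _; split; first by apply: improves_refl => //; exact: ltW.
  by move=> p Kp fp; exfalso; apply: nop; exists p.
have [F FP] := choice step.
pose w := fix w k := if k is l.+1 then F (l, w l) else u.
have wk k : improves u (d * (1 - (2 ^+ k)^-1)) (w k).
  elim: k => [|k IH]; first by rewrite expr0 invr1 subrr mulr0;
    exact: improves_refl.
  have [ak _ _] := IH; have [/= Fk _] := FP (k, w k) ak.
  have := improves_trans _ _ _ _ _ IH Fk.
  have -> // : d * (1 - (2 ^+ k)^-1) + d / 2 ^+ k.+1 = d * (1 - (2 ^+ k.+1)^-1).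
  by rewrite exprS; field; rewrite expf_neq0.
have aw k : admissible (w k) by have [] := wk k.
exists w; split.
- move=> k; have [ak kd kp] := wk k; split => // p Xp.
  by rewrite (le_trans (kd p Xp))// ler_piMr ?(ltW d0)// gerBl invr_ge0
    exprn_ge0.
- move=> k l p kl Xp kp; elim: l kl => [|l IH].
    by rewrite leqn0 => /eqP k0; move: kp; rewrite k0.
  rewrite leq_eqVlt => /predU1P[<-//|/IH lp].
  by have [[_ _ /(_ p Xp lp)]] := FP (l, w l) (aw l).
- move=> p Kp; exists (f p).+1.
  by have [_ /(_ p Kp erefl)] := FP (f p, w (f p)) (aw _).
Qed.

(** Compactness is applied to the following property of a set [S]: beyond some
    index [k], every admissible function that is plurisubharmonic wherever
    [w k] is can be improved so as to become so on [S].  Near a point of [K] or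
    of [Omega] nothing has to be changed once [k] is large. *)
Lemma exists_psh_approximation u d : admissible u -> 0 < d ->
  exists2 v, forall p, X p -> `|v p - u p| <= d & forall p, X p ->
    locally_psh v p.
Proof.
move=> au d0; have d20 : 0 < d / 2 by rewrite divr_gt0.
have [w [uw wmono wK]] := extend_over_countable u _ au d20.
pose Q (S : set V) := exists k, forall v e, 0 < e -> admissible v ->
  (forall p, X p -> locally_psh (w k) p -> locally_psh v p) ->
  exists2 v', improves v e v' & forall p, X p -> S p -> locally_psh v' p.
have : Q X.
  apply: compact_set_ind => //.
  - exact: compact_closure_nrm.
  - by exists 0%N => v e e0 av _; exists v => //; apply: improves_refl => //;
    exact: ltW.
  - move=> A B [k kA] [l lB]; exists (maxn k l) => v e e0 av vkl.
    have e20 : 0 < e / 2 by rewrite divr_gt0.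
    have [|v' vv' v'A] := kA v _ e20 av.
      by move=> p Xp kp; apply: vkl => //; apply: wmono kp => //;
        exact: leq_maxl.
    have [av' _ vv'p] := vv'.
    have [|v'' v'v'' v''B] := lB v' _ e20 av'.
      move=> p Xp lp; apply: vv'p => //; apply: vkl => //.
      by apply: wmono lp => //; exact: leq_maxr.
    exists v''; first by rewrite [e]splitr; exact: improves_trans vv' v'v''.
    have [_ _ v'v''p] := v'v''.
    by move=> p Xp [/(v'A p Xp)/(v'v''p p Xp)|/(v''B p Xp)].
  - move=> A B AB [k kB]; exists k => v e e0 av vk.
    have [v' vv' v'B] := kB v e e0 av vk.
    by exists v' => // p Xp /AB; exact: v'B.
  - move=> p Xp; have refl v e : 0 < e -> admissible v -> improves v e v.
      by move=> e0 av; apply: improves_refl => //; exact: ltW.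
    have [Op|nOp] := pselect (Omega p).
      exists Omega; first exact: open_nbhs_nbhs.
      exists 0%N => v e e0 av _; exists v; first exact: refl.
      by move=> q _; exact: av.2.
    have [Kp|nKp] := pselect (K p).
      have [k kp] := wK p Kp.
      exists [set q | locally_psh (w k) q];
        first exact: (locally_psh_nbhs (w k) p kp).
      exists k => v e e0 av vk; exists v; first exact: refl.
      by move=> q Xq; exact: vk.
    have [|N Np NP] := extend_near_C0 p _.
      by apply: OC0; split => //; split => // /interior_subset.
    by exists N => //; exists 0%N => v e e0 av _; exact: NP.
move=> [k kX]; have [ak kd _] := uw k.
have [v [_ vd _] vp] := kX (w k) _ d20 ak (fun p _ => id).
exists v; last by move=> p Xp; exact: vp.
move=> p Xp; rewrite (le_trans (ler_distD (w k p) _ _))// [d]splitr lerD//.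
  exact: vd.
exact: kd.
Qed.

End Approximation.

(** * The approximating domains *)

Section Domain.
Context {R : realType} {M : normedModType R[i]}.

(** Balls are connected, being unions of segments issued from their centre. *)
Lemma connected_component_open (G : set M) (p : M) :
  open G -> open (connected_component G p).
Proof.
move=> oG; rewrite openE => q pq; rewrite /interior.
have Gq := connected_component_sub pq.
have /nbhs_nrmP[r r0 rG] : nbhs q G by exact: open_nbhs_nbhs.
apply/nbhs_nrmP; exists r => // y yq; apply: connected_component_trans pq _.
pose g (t : R) := q + t%:C *: (y - q).
have cg : continuous g.
  move=> t; exact: (cvg_comp _ _ (@continuous_real_complex R t)
    (@continuous_affine _ _ q (y - q) t%:C)).
exists (g @` `[0, 1]).
  split.
  - by exists 0; rewrite /= ?in_itv/= ?lexx ?ler01// /g scale0r addr0.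
  - move=> _ [t + <-]; rewrite /= in_itv/= => /andP[t0 t1]; apply: rG.
    rewrite /g addrC addKr nrmZ nrm_real ger0_norm// (le_lt_trans _ yq)//.
    by rewrite ler_piMl// nrm_ge0.
  - apply: connected_continuous_connected; first exact: segment_connected.
    exact: continuous_subspaceT.
by exists 1; rewrite /= ?in_itv/= ?lexx ?ler01// /g scale1r subrKC.
Qed.

Lemma closure_nrm_bounded (A : set M) : bounded_set A ->
  exists m : R, forall p, closure A p -> nrm p <= m.
Proof.
move=> [y [_ yA]]; exists (complex.Re (y + 1)) => p.
have cl : closed [set q : M | nrm q <= complex.Re (y + 1)].
  rewrite (_ : [set q : M | _] = nrm @^-1` [set x | x <= complex.Re (y + 1)])//.
  by apply: closed_comp => [? _|]; [exact: continuous_nrm|exact: closed_le].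
rewrite closureE => /(_ _ (conj cl _)); apply => q Aq /=.
have := yA (y + 1) _ q Aq; rewrite ltrDl ltr01 => /(_ isT) /=.
by rewrite nrmE lecE => /andP[].
Qed.

End Domain.

Lemma uniform_cvg_of_le (R : realType) (T : choiceType) (A : set T)
    (v : nat -> T -> R) (u : T -> R) :
  (forall j p, A p -> `|v j p - u p| <= j.+1%:R^-1) ->
  {uniform A, v @ \oo --> u}.
Proof.
move=> vu P /uniform_nbhs[E [entE EP]].
move: entE; rewrite -entourage_ballE => -[e /= e0 eE].
have : \forall j \near \oo, j.+1%:R^-1 < e :> R.
  have := @cvg_harmonic R => /cvgrPdist_lt /(_ e e0); apply: filterS => j.
  by rewrite sub0r normrN ger0_norm// invr_ge0.
apply: filterS => j je; apply: EP => p Ap; apply: eE.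
by rewrite /ball /= distrC (le_lt_trans (vu j p Ap)).
Qed.

Theorem theorem2p3 (R : realType) (n : nat) (Omega : set 'rV[R[i]]_n)
    (K : set 'rV[R[i]]_n) :
  is_domain Omega ->
  bounded_set Omega ->
  countable K ->
  K `<=` boundary Omega ->
  (forall z, (boundary Omega `\` K) z -> C0_boundary_point Omega z) ->
  PSH_Mergelyan Omega.
Proof.
move=> [[p0 Op0] oO cO] bO cK KO OC0 u pshu cu.
have [m Xm] := closure_nrm_bounded Omega bO.
have KX : K `<=` closure Omega by move=> p /KO[].
have cuX : forall p, closure Omega p ->
    u @ within (closure Omega) (nbhs p) --> u p by apply/subspace_continuousP.
have cuO p : Omega p -> {for p, continuous u}.
  move=> Op P /(cuX p (subset_closure Op)) uP.
  have Xp : nbhs p (closure Omega).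
    by apply: filterS (@subset_closure _ Omega) _; exact: open_nbhs_nbhs.
  by apply: filterS2 Xp uP => q Xq; exact.
have au : admissible Omega u.
  by split => // p; exact: locally_psh_of_psh oO cuO pshu.
have ex (j : nat) : exists v, (forall p, closure Omega p ->
    `|v p - u p| <= j.+1%:R^-1) /\ (forall p, closure Omega p ->
      locally_psh v p).
  have [|v vu vp] := exists_psh_approximation Omega m Xm oO K cK KX OC0 u
    j.+1%:R^-1 au.
    by rewrite invr_gt0.
  by exists v.
have [v vP] := choice ex.
pose G j := [set p | locally_psh (v j) p].
have oG j : open (G j).
  by rewrite openE => p /locally_psh_nbhs.
have XG j : closure Omega `<=` G j by case: (vP j).
exists (fun j => connected_component (G j) p0), v; split; last first.
  by apply: uniform_cvg_of_le => j; case: (vP j).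
move=> j; have DG : connected_component (G j) p0 `<=` G j.
  exact: connected_component_sub.
split.
- split; last exact: component_connected.
  + by exists p0; apply: connected_component_refl; apply: XG;
    exact: subset_closure.
  + exact: connected_component_open.
- apply: connected_component_max => //; first exact: subset_closure.
  exact: connected_closure.
- apply: continuous_in_subspaceT => p /set_mem /DG;
  exact: locally_psh_continuous.
- by apply: psh_of_locally_psh => p /DG.
Qed.
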